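(* Let $G$ be a finite group and $H$ a subgroup of $G$. Then the following statements are equivalent: (i) every Sylow $2$-subgroup of $H$ is a perfect code of $G$; (ii) $H$ has a Sylow $2$-subgroup which is a perfect code of $G$; (iii) $H$ is a perfect code of $G$.
   Context: All graphs are finite, undirected and simple. A subset $C$ of the vertex set of a graph $\Gamma$ is a perfect code in $\Gamma$ if no two vertices of $C$ are adjacent and every vertex not in $C$ is adjacent to exactly one vertex of $C$. For a finite group $G$ and a subset $S\subseteq G$ with $S^{-1}=S$ and $1\notin S$, the Cayley graph $\mathrm{Cay}(G,S)$ has vertex set $G$, with $x,y$ adjacent iff $yx^{-1}\in S$. A subset $C$ of $G$ is called a perfect code of $G$ if there exists such an $S$ for which $C$ is a perfect code in $\mathrm{Cay}(G,S)$. *)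

(* Defs.v *)
From mathcomp Require Import all_boot all_fingroup all_solvable.

Set Implicit Arguments.
Unset Strict Implicit.
Unset Printing Implicit Defensive.

Local Open Scope group_scope.

(* The graph has vertex set V and adjacency relation e restricted to V;
   it is simple when e is symmetric and irreflexive on V. *)
Definition perfect_code_in (T : finType) (V : {set T}) (e : rel T)
    (C : {set T}) : Prop :=
  [/\ C \subset V,
      {in C &, forall x y, ~~ e x y}
    & {in V :\: C, forall x, #|[set y in C | e x y]| = 1%N}].

Definition connection_set (gT : finGroupType) (G S : {set gT}) : Prop :=
  [/\ S \subset G, S^-1 = S & 1 \notin S].

Definition cayley_adj (gT : finGroupType) (S : {set gT}) : rel gT :=
  fun x y => y * x^-1 \in S.

Lemma cayley_adj_sym (gT : finGroupType) (G S : {set gT}) :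
  connection_set G S -> symmetric (cayley_adj S).
Proof.
by case=> _ SV _ x y; rewrite /cayley_adj -{1}SV inE invMg invgK.
Qed.

Lemma cayley_adj_irr (gT : finGroupType) (G S : {set gT}) :
  connection_set G S -> irreflexive (cayley_adj S).
Proof. by case=> _ _ S1 x; rewrite /cayley_adj mulgV; apply: negbTE. Qed.

Definition perfect_code_of (gT : finGroupType) (G C : {set gT}) : Prop :=
  exists2 S : {set gT},
    connection_set G S & perfect_code_in G (cayley_adj S) C.

(* Main.v *)
(* A subgroup H is a perfect code of G iff it has an inverse-closed transversal,
   and this holds iff every inverse-closed double coset H x H made of an odd
   number of cosets of H contains an element t with t^-1 = t.  For a 2-subgroup P
   the only such double cosets are the cosets P x with x in N_G(P) and
   x^2 in P.  A Sylow 2-subgroup P of H is then compared with H through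
   K = H :&: H :^ x, which has odd index in H and so contains a Sylow 2-subgroup
   of H: Sylow's theorem in K moves elements of H x H into the normaliser of P,
   and a dihedral argument modulo P moves an involution of H x H into P x. *)

Require Import Defs.
From mathcomp Require Import all_boot all_fingroup all_solvable.

Set Implicit Arguments.
Unset Strict Implicit.
Unset Printing Implicit Defensive.

Local Open Scope group_scope.

(** Deleting a pair [x], [f x] with [f x != x] keeps [A] stable under [f] and its size odd. *)
Lemma odd_involutive_fixpoint (T : finType) (f : T -> T) (A : {set T}) :
    involutive f -> {in A, forall x, f x \in A} -> odd #|A| ->
  exists2 x, x \in A & f x = x.
Proof.
move=> fK; have [n] := ubnP #|A|; elim: n A => // n IHn A leAn fA oddA.
have /card_gt0P[x Ax] : 0 < #|A| by case: #|A| oddA.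
have [fx | fxx] := eqVneq (f x) x; first by exists x.
have cardA : #|A| = #|A :\ x :\ f x|.+2.
  by rewrite (cardsD1 x) Ax (cardsD1 (f x) (A :\ x)) !inE fxx fA.
have [|y||y] := IHn (A :\ x :\ f x).
- by rewrite -ltnS; apply: leq_trans leAn; rewrite cardA.
- rewrite !inE => /and3P[y_fx y_x Ay].
  rewrite fA // andbT (can_eq fK) y_x /=.
  by apply: contraNneq y_fx => <-; rewrite fK.
- by move: oddA; rewrite cardA /= negbK.
- by rewrite !inE => /and3P[_ _ Ay]; exists y.
Qed.

(** * Double cosets of a subgroup *)

Lemma mem_double_coset (gT : finGroupType) (H : {group gT}) (x y : gT) :
  reflect (exists a b, [/\ a \in H, b \in H & y = a * x * b])
          (y \in H :* x * H).
Proof.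
apply: (iffP mulsgP) => [[u b /rcosetP[a Ha ->] Hb ->] | [a [b [Ha Hb ->]]]].
  by exists a, b.
by exists (a * x) b => //; apply/rcosetP; exists a.
Qed.

Lemma double_coset_id (gT : finGroupType) (H : {group gT}) (x : gT) :
  x \in H :* x * H.
Proof. by apply/mem_double_coset; exists 1, 1; rewrite !group1 mul1g mulg1. Qed.

Lemma double_coset_eq (gT : finGroupType) (H : {group gT}) (x y : gT) :
  y \in H :* x * H -> H :* y * H = H :* x * H.
Proof.
case/mem_double_coset=> a [b [Ha Hb ->]].
by rewrite !rcosetM (rcoset_id Ha) -(mulgA (H :* x)) (lcoset_id Hb).
Qed.

Lemma inv_double_coset (gT : finGroupType) (H : {group gT}) (x : gT) :
  (H :* x * H)^-1 = H :* x^-1 * H.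
Proof. by rewrite invMg invGid invg_rcoset mulgA. Qed.

Lemma mem_mul_double_coset (gT : finGroupType) (H : {group gT}) (x h y : gT) :
  h \in H -> y \in H :* x * H -> h * y \in H :* x * H.
Proof.
move=> Hh /mem_double_coset[a [b [Ha Hb ->]]].
by apply/mem_double_coset; exists (h * a), b; rewrite groupM ?mulgA.
Qed.

Lemma card_double_coset (gT : finGroupType) (H : {group gT}) (x : gT) :
  #|H :* x * H| = (#|H :* x * H : H| * #|H|)%N.
Proof.
apply: card_uniform_partition => [_ /rcosetsP[y _ ->]|].
  by rewrite card_rcoset.
apply/and3P; split.
- rewrite /cover eqEsubset; apply/andP; split; apply/subsetP=> y.
    case/bigcupP=> _ /rcosetsP[z Dz ->] /rcosetP[h Hh ->].
    exact: mem_mul_double_coset.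
  move=> Dy; apply/bigcupP; exists (H :* y); last exact: rcoset_refl.
  by apply/rcosetsP; exists y.
- apply/trivIsetP=> _ _ /rcosetsP[y _ ->] /rcosetsP[z _ ->].
  by apply: contraR => /pred0Pn[u /andP[/= /rcoset_eqP <- /rcoset_eqP <-]].
- by apply/rcosetsP=> -[y _ /setP/(_ y)]; rewrite rcoset_refl inE.
Qed.

(** Left translation by [x^-1] turns H x H into the product of [H :^ x] and [H], and the product
    formula gives its order. *)
Lemma index_double_coset (gT : finGroupType) (H : {group gT}) (x : gT) :
  #|H :* x * H : H| = #|H : H :&: H :^ x|.
Proof.
have cardD : #|H :* x * H| = #|(H :^ x) * H|.
  by rewrite conjsgE -!mulgA card_lcoset mulgA.
have := mul_cardG (H :^ x) H.
rewrite -cardD card_double_coset cardJg setIC -{2}(Lagrange (subsetIl H (H :^ x))).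
rewrite (mulnC _ #|H|) -mulnA (mulnC #|_ : H|) => /eqP.
by rewrite !eqn_pmul2l ?cardG_gt0 // => /eqP <-.
Qed.

(** * Perfect codes as inverse-closed transversals *)

(** The neighbours of [x^-1] in [H] are the [y] in [H] with [y * x] in [S], so they correspond to
    the points of [S] in [H :* x]. Unique domination thus says that [S] meets each coset other than
    [H] exactly once, and independence that [S] misses [H]. *)
Lemma perfect_code_transversalP (gT : finGroupType) (G H : {group gT}) :
    H \subset G ->
  perfect_code_of G H <->
  exists2 S : {set gT}, [/\ S \subset G :\: H, S^-1 = S
                          & {in S &, injective (rcoset H)}]
    & {in G :\: H, forall x, exists2 s, s \in S & s \in H :* x}.
Proof.
move=> sHG; split=> [[S [sSG SV S1] [_ S_H S_G]] | [S [sS SV injS] hitS]].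
  have sSGH : S \subset G :\: H.
    apply/subsetP=> s Ss; rewrite inE (subsetP sSG) // andbT.
    apply: contraL (Ss) => Hs; move: (S_H _ _ (group1 H) Hs).
    by rewrite /cayley_adj invg1 mulg1.
  have hit x : x \in G :\: H -> exists y, [set y in H | y * x \in S] = [set y].
    move=> GHx; have /S_G/eqP/cards1P[y Dy] : x^-1 \in G :\: H.
      by move: GHx; rewrite !inE !groupV.
    exists y; rewrite -Dy; apply/setP=> z.
    by rewrite !inE /cayley_adj invgK.
  exists S; first split=> //.
    move=> s t Ss St; rewrite !rcosetE => /esym/rcoset_eqP/rcosetP[h Hh def_t].
    have [y Dy] := hit s (subsetP sSGH s Ss).
    have : 1 \in [set y in H | y * s \in S] by rewrite inE group1 mul1g.
    rewrite Dy inE => /eqP y1.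
    have : h \in [set y in H | y * s \in S] by rewrite inE Hh -def_t.
    by rewrite Dy inE -y1 => /eqP h1; rewrite def_t h1 mul1g.
  move=> x GHx; have [y Dy] := hit x GHx.
  have : y \in [set y in H | y * x \in S] by rewrite Dy inE.
  rewrite inE => /andP[Hy Syx]; exists (y * x) => //.
  by apply/rcosetP; exists y.
have SnH s : s \in S -> s \notin H by move/(subsetP sS); rewrite inE => /andP[].
exists S; first split=> //.
- exact: subset_trans sS (subsetDl _ _).
- by apply: contraL (group1 H) => /SnH.
split=> // [x y Hx Hy | x GHx]; rewrite /cayley_adj.
  by apply: contraL (Hy) => /SnH; apply: contra => Hy'; rewrite groupM ?groupV.
apply/eqP/cards1P.
have [|s Ss /rcosetP[h Hh def_s]] := hitS x^-1.
  by move: GHx; rewrite !inE !groupV.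
exists h; apply/setP=> y; rewrite !inE /cayley_adj.
apply/andP/eqP=> [[Hy Syx] | ->]; last by rewrite Hh -def_s.
apply: (mulIg x^-1); rewrite -def_s; apply: injS => //.
rewrite !rcosetE; apply/rcoset_eqP; rewrite def_s mem_rcoset.
by rewrite invMg invgK mulgA mulgKV groupM ?groupV.
Qed.

(* The fixed points of inversion on the transversal: it meets the inverse-closed
   set H x H in an odd number of points. *)
Lemma perfect_code_double_coset_involution
    (gT : finGroupType) (G H : {group gT}) (x : gT) :
    H \subset G -> perfect_code_of G H -> x \in G ->
    x^-1 \in H :* x * H -> odd #|H : H :&: H :^ x| ->
  exists2 t, t \in H :* x * H & t^-1 = t.
Proof.
move=> sHG /(perfect_code_transversalP sHG)[S [sS SV injS] hitS] Gx DxV oddD.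
set D := H :* x * H in DxV *.
have [Hx | nHx] := boolP (x \in H).
  exists 1; last by rewrite invg1.
  by rewrite /D rcoset_id // mulGid.
have DV : D^-1 = D by rewrite inv_double_coset (double_coset_eq DxV).
have sDG : D \subset G :\: H.
  apply/subsetP=> _ /mem_double_coset[a [b [Ha Hb ->]]].
  by rewrite inE groupMr // groupMl // nHx !groupM // (subsetP sHG).
have [|||t] := @odd_involutive_fixpoint _ (fun y : gT => y^-1) (S :&: D).
- exact: invgK.
- by move=> s; rewrite !inE -{1}SV -{1}DV !inE.
- suff <- : #|D : H| = #|S :&: D| by rewrite index_double_coset.
  rewrite -(card_in_imset (f := rcoset H) (D := mem (S :&: D))); last first.
    by move=> s t /setIP[Ss _] /setIP[St _]; apply: injS.
  congr #|pred_of_set _|; apply/setP=> C.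
  apply/imsetP/imsetP=> [[y Dy ->]|[y /setIP[_ Dy] ->]]; last by exists y.
  have [s Ss sHy] := hitS y (subsetP sDG y Dy).
  exists s; last by rewrite !rcosetE; apply/esym/rcoset_eqP.
  rewrite inE Ss; case/rcosetP: sHy => h Hh ->.
  exact: mem_mul_double_coset.
by case/setIP=> _ Dt tV; exists t.
Qed.

(* A maximal inverse-closed partial transversal is a transversal: if it missed
   H x, it could be enlarged by a pair t, t^-1 in two missed cosets, or by an
   involution in H x. *)
Lemma involution_perfect_code (gT : finGroupType) (G H : {group gT}) :
    H \subset G ->
    (forall x, x \in G -> x^-1 \in H :* x * H -> odd #|H : H :&: H :^ x| ->
       exists2 t, t \in H :* x * H & t^-1 = t) ->
  perfect_code_of G H.
Proof.
move=> sHG invD; apply/perfect_code_transversalP => //.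
pose partial (S : {set gT}) :=
  [&& S \subset G :\: H, S^-1 == S & dinjectiveb (rcoset H) (mem S)].
have [|S /maxsetP[/and3P[sS /eqP SV /dinjectiveP injS] maxS] _] :=
    @maxset_exists _ partial set0.
  rewrite /partial sub0set /=; apply/andP; split.
    by apply/eqP/setP=> x; rewrite !inE.
  by apply/dinjectiveP=> x y; rewrite inE.
exists S => // x GHx; have [Gx nHx] := setDP GHx.
suff: ~~ [disjoint S & H :* x].
  by case/pred0Pn=> s /andP[/= Ss xs]; exists s.
apply/negP=> missx.
have missP y s : [disjoint S & H :* y] -> s \in S -> H :* s <> H :* y.
  by move=> miss Ss /rcoset_eqP; apply/negP; rewrite (disjointFr miss Ss).
have extend t : t \in G :\: H -> [disjoint S & H :* t] ->
    [disjoint S & H :* t^-1] -> (H :* t = H :* t^-1 -> t = t^-1) -> False.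
  move=> GHt misst misstV Ht.
  suff /maxS SE : partial (t |: (t^-1 |: S)).
    have := disjointFl misst (rcoset_refl H t).
    by rewrite -SE ?setU11 // setUA subsetUr.
  apply/and3P; split.
  - rewrite !subUset !sub1set sS GHt andbT /=.
    by move: GHt; rewrite !inE !groupV.
  - apply/eqP/setP=> y; rewrite !inE (can2_eq invgK invgK) (inj_eq invg_inj).
    by rewrite orbCA -{2}SV inE.
  - apply/dinjectiveP=> y z; rewrite !inE !rcosetE.
    case/or3P=> [/eqP->|/eqP->|Sy]; case/or3P=> [/eqP->|/eqP->|Sz] Hyz //.
    + exact: Ht.
    + by case: (missP _ _ misst Sz).
    + by apply/esym/Ht.
    + by case: (missP _ _ misstV Sz).
    + by case: (missP _ _ misst Sy).
    + by case: (missP _ _ misstV Sy).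
    + by apply: injS; rewrite ?rcosetE.
pose D := H :* x * H.
pose missed A := rcosets H A :\: rcoset H @: (S :&: A).
have missed_disjoint C y : C \in missed (H :* y * H) ->
    exists2 z, C = H :* z & z \in H :* y * H /\ [disjoint S & H :* z].
  case/setDP=> /rcosetsP[z Dz ->] /imsetP missz; exists z => //; split=> //.
  apply/pred0P=> s; apply/negP=> /andP[/= Ss zs]; case: missz; exists s.
    by rewrite inE Ss; case/rcosetP: zs => h Hh ->; apply: mem_mul_double_coset.
  by rewrite rcosetE; apply/esym/rcoset_eqP.
have card_missed A : #|missed A| = (#|A : H| - #|S :&: A|)%N.
  rewrite cardsD (setIidPr _); last by rewrite imsetS // subsetIr.
  by rewrite card_in_imset // => s t /setIP[Ss _] /setIP[St _]; apply: injS.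
have GHmul h y : h \in H -> y \in G :\: H -> h * y \in G :\: H.
  by move=> Hh /setDP[Gy nHy]; rewrite inE !groupMl // ?nHy // (subsetP sHG).
have Hmul h y : h \in H -> H :* (h * y) = H :* y.
  by move=> Hh; rewrite rcosetM rcoset_id.
(* Some [a * x] in [H :* x] has its inverse in [H :* y]; if the two cosets differed, this pair would
   enlarge [S]. *)
have unique_missed y : y \in D^-1 -> [disjoint S & H :* y] -> H :* y = H :* x.
  rewrite inE => /mem_double_coset[a [b [Ha Hb def_yV]]] missy.
  have tV : (a * x)^-1 = b * y.
    by rewrite -[y]invgK def_yV !invMg mulKVg.
  apply/eqP; apply: contraT => /eqP yx; exfalso.
  apply: (extend (a * x)); rewrite ?tV ?Hmul ?GHmul //.
  by move=> /esym.
(* Conjugation by [b^-1] in [H] would move such a [t] into the missed coset [H :* x]. *)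
have no_involution t : t \in D -> t^-1 <> t.
  case/mem_double_coset=> a [b [Ha Hb ->]] tV.
  have uV : (b * a * x)^-1 = b * a * x.
    have -> : b * a * x = (a * x * b) ^ b^-1 by rewrite conjgE invgK !mulgA mulgK.
    by rewrite -conjVg tV.
  by apply: (extend (b * a * x)); rewrite ?uV ?Hmul ?GHmul ?groupM.
have missDx : H :* x \in missed D.
  rewrite inE andbC; apply/andP; split.
    by apply/rcosetsP; exists x => //; apply: double_coset_id.
  by apply/imsetP=> -[s /setIP[Ss _]]; rewrite rcosetE => /esym; apply: missP.
have DVE : D^-1 = H :* x^-1 * H := inv_double_coset H x.
(* Inversion does not send right cosets to right cosets, but it preserves the sizes of [D] and of
   [S :&: D], hence the number of missed cosets. *)
have card_missedV : #|missed D^-1| = #|missed D|.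
  rewrite !card_missed; congr (_ - _)%N; last by rewrite -{1}SV -invIg card_invg.
  apply/eqP; rewrite -(eqn_pmul2r (cardG_gt0 H)) -card_double_coset.
  by rewrite DVE -card_double_coset -DVE card_invg.
have DV : D^-1 = D.
  have /card_gt0P[C] : 0 < #|missed D^-1|.
    by rewrite card_missedV; apply/card_gt0P; exists (H :* x).
  rewrite DVE => /missed_disjoint[y _ [Dy missy]].
  have := unique_missed y; rewrite DVE => /(_ Dy missy).
  move/esym/rcoset_eqP/rcosetP=> [h Hh def_x].
  by apply/esym/double_coset_eq; rewrite {1}def_x mem_mul_double_coset.
have card1 : #|missed D| = 1%N.
  apply/eqP/cards1P; exists (H :* x); apply/setP=> C; rewrite inE.
  apply/idP/eqP=> [/missed_disjoint[y -> [Dy missy]] | -> //].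
  by apply: unique_missed; rewrite ?DV.
(* Parity contradiction: [S :&: D] and the set of cosets in [D] both have even size, yet exactly one
   coset of [D] is missed. *)
have even_S : ~~ odd #|S :&: D|.
  apply/negP=> /odd_involutive_fixpoint fixp.
  have [||s /setIP[_ Ds]] := fixp (fun y : gT => y^-1); first exact: invgK.
    by move=> s; rewrite !inE -{1}SV -{1}DV !inE.
  exact: no_involution.
have even_D : ~~ odd #|D : H|.
  apply/negP; rewrite index_double_coset => /(invD x Gx)[|t Dt]; last first.
    exact: no_involution.
  by rewrite -/D -DV inE invgK double_coset_id.
have ltSD : #|S :&: D| < #|D : H| by rewrite -subn_gt0 -card_missed card1.
have := oddB (ltnW ltSD).
by rewrite -card_missed card1 (negPf even_D) (negPf even_S).
Qed.

(** * 2-subgroups and pairs of involutions *)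

(** The index of [P :&: P :^ x] in [P] is a power of 2, so it is odd only if [x] normalises [P].
    Then P x P is [P :* x], which contains [x^-1] exactly when [x ^+ 2] is in [P]. *)
Lemma perfect_code_2groupP (gT : finGroupType) (G P : {group gT}) :
    P \subset G -> 2.-group P ->
  perfect_code_of G P <->
  forall x, x \in 'N_G(P) -> x ^+ 2 \in P -> exists2 t, t \in P :* x & t^-1 = t.
Proof.
move=> sPG pP; split=> [codeP x /setIP[Gx nPx] Px2 | invP].
  have -> : P :* x = P :* x * P.
    by rewrite -(normC (A := [set x])) ?sub1set // -mulgA mulGid.
  apply: (perfect_code_double_coset_involution sPG codeP Gx).
    apply/mem_double_coset; exists (x ^- 2), 1.
    by rewrite groupV Px2 group1 mulg1 expgS expg1 invMg mulgKV.
  by rewrite (normP nPx) setIid indexgg.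
apply: involution_perfect_code => // x Gx.
case/mem_double_coset=> a [b [Pa Pb def_xV]] oddP.
have nPx : x \in 'N(P).
  have : #|P : P :&: P :^ x| == 1%N.
    apply/eqP/(pnat_1 (pi := 2)); last by rewrite -odd_2'nat.
    exact: pnat_dvd (dvdn_indexg _ _) pP.
  rewrite indexg_eq1 subsetI => /andP[_ sPPx].
  by apply/normP/esym/eqP; rewrite eqEcard cardJg sPPx leqnn.
have [||t Pxt tV] := invP x; first by rewrite inE Gx.
  have -> : x ^+ 2 = a^-1 * b^-1 ^ x.
    by rewrite conjgE def_xV -!mulgA mulKg mulKVg.
  by rewrite groupM ?memJ_norm ?groupV.
exists t => //; case/rcosetP: Pxt => h Ph ->.
by apply: mem_mul_double_coset; last apply: double_coset_id.
Qed.

(* The dihedral relation c^b = c^-1 for c = a b, of odd order 2 m + 1, gives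
   b^(c^m) = c^(-2m) b = c b = a. *)
Lemma involutions_conj_odd (gT : finGroupType) (a b : gT) :
    a ^+ 2 = 1 -> b ^+ 2 = 1 -> odd #[a * b] ->
  exists m, b ^ ((a * b) ^+ m) = a.
Proof.
move=> a2 b2 oddc; exists #[a * b]./2; set c := a * b; set m := _./2.
have bV : b^-1 = b by apply/eqP; rewrite eq_invg_mul -expg2 b2.
have aV : a^-1 = a by apply/eqP; rewrite eq_invg_mul -expg2 a2.
have cb : c ^ b = c^-1.
  by rewrite conjgE /c invMg aV bV -!mulgA -expg2 b2 mulg1.
have cm : c ^+ m * (c ^+ m * c) = 1.
  have cardc : (m + m.+1)%N = #[c].
    by rewrite addnS addnn -[RHS]odd_double_half oddc.
  by rewrite -expgSr -expgD cardc expg_order.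
rewrite conjgE [b * _]conjgCV bV conjXg cb expgVn.
have -> : a = c * b by rewrite /c -mulgA -expg2 b2 mulg1.
rewrite mulgA; congr (_ * _).
by apply/eqP; rewrite -invMg eq_invg_mul -mulgA cm.
Qed.

(** * From a subgroup to its Sylow 2-subgroups *)

Lemma odd_index_Sylow2 (gT : finGroupType) (H K P : {group gT}) :
    P \subset K -> K \subset H -> 2.-Sylow(H) P -> odd #|H : K|.
Proof.
move=> sPK sKH /and3P[_ _ p'HP]; rewrite odd_2'nat.
by apply: pnat_dvd p'HP; rewrite -(Lagrange_index sKH sPK) dvdn_mulr.
Qed.

Lemma perfect_code_Sylow2 (gT : finGroupType) (G H P : {group gT}) :
    H \subset G -> 2.-Sylow(H) P -> perfect_code_of G H -> perfect_code_of G P.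
Proof.
move=> sHG sylP codeH; have [sPH pP _] := and3P sylP.
apply/(perfect_code_2groupP (subset_trans sPH sHG) pP) => x /setIP[Gx nPx] Px2.
have [||t] := perfect_code_double_coset_involution sHG codeH Gx.
- apply/mem_double_coset; exists (x ^- 2), 1.
  by rewrite groupV (subsetP sPH) // group1 mulg1 expgS expg1 invMg mulgKV.
- apply: odd_index_Sylow2 sylP; last exact: subsetIl.
  by rewrite subsetI sPH -{1}(normP nPx) conjSg.
case/mem_double_coset=> a [b [Ha Hb def_t]] tV.
(* Conjugating [t] by [a] gathers the factors from [H] on the right, so [u] squares to 1 and lies in
   [x *: H]. *)
pose u := x * (b * a).
have def_u : u = t ^ a by rewrite def_t conjgE /u -!mulgA mulKg.
have uV : u^-1 = u by rewrite def_u -conjVg tV.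
have Hba : b * a \in H by rewrite groupM.
pose K := (H :&: H :^ u)%G.
(* As [u = u^-1], [H :^ u] equals [H :^ x^-1], which contains [P] because [x] normalises [P]. *)
have sPK : P \subset K.
  rewrite subsetI sPH /= -uV /u invMg conjsgM conjGid ?groupV //.
  by rewrite -[P : {set gT}](normP (groupVr nPx)) conjSg.
have nKu : u \in 'N(K).
  by rewrite inE /= conjIg -conjsgM -{2}uV mulVg conjsg1 setIC.
have sylPK : 2.-Sylow(K) P := pHall_subl sPK (subsetIl _ _) sylP.
have u2 : u ^+ 2 = 1 by rewrite expg2 -{1}uV mulVg.
(* [Q] contains [u] and meets the normal subgroup [K] in a Sylow 2-subgroup of [K], which [u]
   normalises. Moving that subgroup to [P] by [k] in [K] makes [v = u ^ k] normalise [P]. *)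
have [|Q sylQ sUQ] := Sylow_superset (joing_subr K <[u]>) (p := 2).
  rewrite /pgroup -orderE.
  by apply: pnat_dvd (_ : #[u] %| 2) _; rewrite ?order_dvdn ?u2.
have nKY : K <| K <*> <[u]> by rewrite normalYl cycle_subG.
have [k Kk defP] := Sylow_trans (Sylow_setI_normal nKY sylQ) sylPK.
pose v := u ^ k.
have nPv : v \in 'N(P).
  rewrite defP /= normJ memJ_conjg; apply: (subsetP (normsI _ _)) (cycle_id u).
    by rewrite cycle_subG.
  exact: subset_trans sUQ (normG Q).
have Hh : x^-1 * v \in H.
  have -> : x^-1 * v = (b * a) * ((k^-1) ^ u * k).
    by apply: (mulgI x); rewrite mulKVg mulgA -/u mulgA -conjgC -mulgA -conjgE.
  have := memJ_norm k^-1 nKu; rewrite groupV Kk => /setIP[Hku _].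
  exact: groupM Hba (groupM Hku (subsetP (subsetIl _ _) k Kk)).
have v2 : v ^+ 2 = 1 by rewrite -conjXg u2 conj1g.
have nPh : x^-1 * v \in 'N_H(P) by rewrite inE Hh groupM ?groupV.
have cosetxV : coset P x^-1 = coset P x.
  apply/rcoset_kercosetP; rewrite ?groupV // mem_rcoset.
  by rewrite -invMg groupV -expg2.
(* Modulo [P], both [x] and [v] square to 1, and their product lies in ['N_H(P) / P], of odd order
   since [P] is Sylow in [H]. *)
have [|||m conj_v] := @involutions_conj_odd _ (coset P x) (coset P v).
- by rewrite -morphX //= coset_id.
- by rewrite -morphX // v2 morph1.
- rewrite -cosetxV -morphM ?groupV // odd_2'nat.
  apply: (@pnat_dvd _ #|'N_H(P) / P|); first by rewrite order_dvdG ?mem_quotient.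
  rewrite card_quotient ?subsetIr // -odd_2'nat.
  apply: (odd_index_Sylow2 (subxx P)); first by rewrite subsetI sPH normG.
  by apply: pHall_subl sylP; rewrite ?subsetIl // subsetI sPH normG.
pose g := (x^-1 * v) ^+ m.
have nPg : g \in 'N(P) by rewrite groupX // groupM ?groupV.
exists (v ^ g); last by rewrite -conjVg /v -conjVg uV.
apply/rcoset_kercosetP; [exact: groupJ | by [] |].
rewrite morphJ //= -[RHS]conj_v -cosetxV -morphM ?groupV //.
by rewrite -morphX // groupM ?groupV.
Qed.

(** * From a Sylow 2-subgroup to the subgroup *)

Lemma odd_order_sqr_mem (gT : finGroupType) (K : {group gT}) (w : gT) :
  odd #[w] -> w ^+ 2 \in K -> w \in K.
Proof.
move=> oddw Kw2; have def_w : (2 * uphalf #[w])%N = #[w].+1.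
  by rewrite mul2n uphalf_half oddw doubleD -[in RHS](odd_double_half #[w]) oddw.
have -> : w = w ^+ 2 ^+ uphalf #[w].
  by rewrite -expgM def_w expgSr expg_order mul1g.
by rewrite groupX.
Qed.

Lemma Sylow2_perfect_code (gT : finGroupType) (G H P : {group gT}) :
    H \subset G -> 2.-Sylow(H) P -> perfect_code_of G P -> perfect_code_of G H.
Proof.
move=> sHG sylP codeP; have [sPH pP _] := and3P sylP.
move/(perfect_code_2groupP (subset_trans sPH sHG) pP): codeP => invP.
apply: involution_perfect_code => // x Gx.
case/mem_double_coset=> a [b [Ha Hb def_xV]].
(* This representative of H x H has its square [b^-1 * a] in [H], so it normalises
   [H :&: H :^ z]. *)
have [z zE] : exists z, z = x * a by exists (x * a).
have Dz : z \in H :* x * H.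
  by rewrite zE; apply/mem_double_coset; exists 1, a; rewrite group1 mul1g.
rewrite -index_double_coset -(double_coset_eq Dz) index_double_coset => oddK.
have Hz2 : z ^+ 2 \in H.
  have -> : z ^+ 2 = b^-1 * a.
    have -> : b = x^-1 * a^-1 * x^-1.
      by rewrite {2}def_xV -!mulgA !mulKg.
    by rewrite zE expg2 !invMg !invgK !mulgA.
  by rewrite groupM ?groupV.
have Gz : z \in G by rewrite zE; apply: groupM Gx (subsetP sHG a Ha).
pose K := (H :&: H :^ z)%G.
have nKz : z \in 'N(K).
  rewrite inE /= conjIg -conjsgM -expg2 setIC; apply: setSI.
  by rewrite conjGid.
have Kz2 : z ^+ 2 \in K.
  by rewrite inE Hz2 /= mem_conjg conjXg conjgE invgK mulgV mulg1.
have [R sylR] := Sylow_exists 2 K.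
have sylRH : 2.-Sylow(H) R.
  have [sRK pR p'KR] := and3P sylR.
  rewrite pHallE (subset_trans sRK (subsetIl _ _)) /=.
  rewrite (card_Hall sylR) -(Lagrange (subsetIl H (H :^ z))) partnM ?cardG_gt0 //.
  by rewrite [X in (_ * X)%N]part_p'nat ?muln1 // -odd_2'nat.
have [sRK _ _] := and3P sylR.
have sylRz : 2.-Sylow(K) (R :^ z)%G by rewrite pHallJnorm.
have [k Kk defRz] := Sylow_trans sylR sylRz.
(* The factor [k^-1] from [K] corrects [z] so that it normalises [R], while the square stays in
   [K]. *)
pose n := z * k^-1.
have nRn : n \in 'N(R).
  by apply/normP; rewrite conjsgM [R :^ z]defRz -conjsgM mulgV conjsg1.
have Kn2 : n ^+ 2 \in K.
  have -> : n ^+ 2 = z ^+ 2 * (k^-1 ^ z * k^-1).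
    by rewrite !expg2 /n conjgE !mulgA mulgK.
  by rewrite (groupM Kz2) // groupM ?memJ_norm ?groupV.
(* The odd part of [n] lies in [K], so the 2-part [y] is still in [z *: K]; its square is a
   2-element of ['N_K(R)], hence lies in [R]. *)
have Kw : n.`_2^' \in K.
  apply: odd_order_sqr_mem; first by rewrite odd_2'nat; apply: p_elt_constt.
  by rewrite -consttX groupX.
pose y := n.`_2.
have nRy : y \in 'N(R) by apply: groupX.
have Gy : y \in G.
  by apply: groupX; rewrite groupM ?groupV //; case/setIP: Kk => /(subsetP sHG).
have Ry2 : y ^+ 2 \in R.
  have sRN : R \subset 'N_K(R) by rewrite subsetI sRK normG.
  have sylRN := pHall_subl sRN (subsetIl _ _) sylR.
  have nRN : R <| 'N_K(R) by apply/andP; split; last exact: subsetIr.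
  have NKy2 : y ^+ 2 \in 'N_K(R).
    by rewrite inE (groupX 2 nRy) andbT -consttX groupX.
  by rewrite (mem_normal_Hall sylRN nRN NKy2) p_eltX // p_elt_constt.
(* Conjugation by [h] carries [P] to [R]: the hypothesis on [P] then gives a self-inverse element of
   [R :* y], which is contained in H z H. *)
have [h Hh defR] := Sylow_trans sylP sylRH.
have [||t Pt tV] := invP (y ^ h^-1).
- rewrite inE groupJ ?groupV ?(subsetP sHG h) //=.
  by rewrite -mem_conjg -normJ -defR.
- by rewrite -conjXg -mem_conjg -defR.
exists (t ^ h); last by rewrite -conjVg tV.
have [p Pp ->] := rcosetP Pt; rewrite conjMg conjgKV.
have Rp : p ^ h \in R by rewrite defR memJ_conjg.
have sKH : K \subset H := subsetIl _ _.
have -> : y = z * (k^-1 * (n.`_2^')^-1).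
  by apply: (mulIg n.`_2^'); rewrite /y consttC -!mulgA mulVg mulg1.
apply/mem_double_coset; exists (p ^ h), (k^-1 * (n.`_2^')^-1).
split; rewrite ?mulgA //; first exact: subsetP sKH _ (subsetP sRK _ Rp).
by apply: subsetP sKH _ _; rewrite groupM ?groupV.
Qed.

Theorem theorem1p1 (gT : finGroupType) (G H : {group gT}) (sHG : H \subset G) :
  [<-> forall P : {group gT}, 2.-Sylow(H) P -> perfect_code_of G P;
       exists2 P : {group gT}, 2.-Sylow(H) P & perfect_code_of G P;
       perfect_code_of G H].
Proof.
tfae=> [codeS | [P sylP codeP] | codeH P sylP].
- by have [P sylP] := Sylow_exists 2 H; exists P; last apply: codeS.
- exact: Sylow2_perfect_code sylP codeP.
- exact: perfect_code_Sylow2 sylP codeH.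
Qed.
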